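(* Let $\alpha$ and $\beta=(\beta_1,\dots,\beta_k)$ be partitions of $n$, let $m=\operatorname{lcm}(\beta_1,\dots,\beta_k)=p_1^{a_1}\cdots p_r^{a_r}$ (prime factorization) and let $W(m)=\{n_1p_1+\cdots+n_rp_r \mid n_i\in\mathbb{N}_0\}$. If $\chi^{\alpha}(1^n)\notin W(m)$, then $\chi^{\alpha}(\beta)\neq 0$.
   Context: $\mathbb{N}_0$ is the set of non-negative integers. For a partition $\alpha$ of $n$, $\chi^\alpha$ denotes the irreducible complex character of the symmetric group $S_n$ labeled by $\alpha$; for a partition $\beta$ of $n$, $\chi^\alpha(\beta)$ is its value on the conjugacy class of elements of cycle type $\beta$. Thus $\chi^\alpha(1^n)$ is the degree of $\chi^\alpha$. *)

(* Defs.v *)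
From mathcomp Require Import all_boot all_order all_algebra all_fingroup.
From mathcomp Require Import all_solvable all_field all_character.

Set Implicit Arguments.
Unset Strict Implicit.
Unset Printing Implicit Defensive.

Import GRing.Theory.
Local Open Scope ring_scope.

Definition is_partition (n : nat) (alpha : seq nat) : bool :=
  [&& sorted geq alpha, all (ltn 0) alpha & sumn alpha == n].

(* Fixed tableau of shape alpha: the box in row [reshape_index alpha i] and
   column [reshape_offset alpha i] contains i, i.e. the entries 0, ..., n-1 are
   written row after row. *)
Definition row_stab (n : nat) (alpha : seq nat) : {set 'S_n} :=
  [set s : 'S_n | [forall i : 'I_n,
     reshape_index alpha (s i) == reshape_index alpha i]].

Definition col_stab (n : nat) (alpha : seq nat) : {set 'S_n} :=
  [set s : 'S_n | [forall i : 'I_n,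
     reshape_offset alpha (s i) == reshape_offset alpha i]].

(* Young symmetrizer \sum_(p, q) sgn(q) p q, as a row vector of the group
   algebra algC['S_n] in its standard basis (the elements of 'S_n). *)
Definition young_symmetrizer (n : nat) (alpha : seq nat) :
    'rV[algC]_#|[set: 'S_n]| :=
  \sum_(p in row_stab n alpha) \sum_(q in col_stab n alpha)
    (-1) ^+ q *: delta_mx 0 (gring_index [set: 'S_n]%G (p * q)%g).

(* The Specht module: the right ideal generated by the Young symmetrizer, on
   which 'S_n acts by right multiplication. *)
Definition specht_repr (n : nat) (alpha : seq nat) :=
  submod_repr (cyclic_mx_module (regular_repr algC [set: 'S_n]%G)
                                (young_symmetrizer n alpha)).

Definition sym_char (n : nat) (alpha : seq nat) : 'CF([set: 'S_n]) :=
  cfRepr (specht_repr n alpha).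

Definition has_cycle_type (n : nat) (g : 'S_n) (beta : seq nat) : bool :=
  perm_eq [seq #|X| | X : {set 'I_n} <- enum (porbits g)] beta.

Definition lcm_seq (beta : seq nat) : nat := \big[lcmn/1%N]_(b <- beta) b.

Definition in_W (m : nat) (x : algC) : Prop :=
  exists c : nat -> nat, x = (\sum_(p <- primes m) c p * p)%N%:R.

(* Main.v *)
Require Import Defs.
From mathcomp Require Import all_boot all_order all_algebra all_fingroup.
From mathcomp Require Import all_solvable all_field all_character.

Set Implicit Arguments.
Unset Strict Implicit.
Unset Printing Implicit Defensive.

Import GRing.Theory Num.Theory.
Local Open Scope ring_scope.

(** If [chi] is the character of any representation of the symmetric group over
the algebraic numbers and [g ^+ m = 1], the eigenvalues of [g] are [m]-th roots
of unity, [chi g] is their sum and [chi 1] their number. For [k] coprime to [m]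
the permutations [g] and [g ^+ k] are conjugate ([perm_pow_conj]), so the
multiset [E] of eigenvalues is stable under [x |-> x ^+ k]. Hence the
multiplicity [c d] of a root of unity in [E] depends only on its order [d], and
summing over [E] amounts to summing over the classes of primitive roots of unity
([sum_order_classes]). It remains to see that if [E] sums to zero, then its size
[\sum_(d %| m) c d * totient d] lies in the semigroup generated by the primes
dividing [m] ([sum_galois_stable_eq0]).

If [c d != 0] for some [d] with two distinct prime divisors [p] and [q], the size
is at least [totient d >= p.-1 * q.-1], and by Sylvester's solution of the
two-coin problem every such number is of the form [a * p + b * q].

Otherwise [c d != 0] only if [d] is [1] or a prime power. The primitive roots of
order [1], [p] and [p ^ a] with [a >= 2] sum to [1], [-1] and [0] respectively, so
the vanishing of the sum says that [c 1] is the sum of the [c p] over the primes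
[p]. The size is therefore the sum of the numbers [c p * (1 + totient p) = c p * p]
and of the numbers [c (p ^ a) * totient (p ^ a)] with [a >= 2], which are multiples
of [p]. In particular nothing is needed about vanishing sums of roots of unity
that are not stable under the Galois action. *)

(** * The semigroup generated by the primes dividing an integer *)

(** The set W(m) as a predicate on natural numbers; [in_W m] is its image among
the algebraic numbers. *)
Definition semigroupW (m x : nat) : Prop :=
  exists c : nat -> nat, x = (\sum_(p <- primes m) c p * p)%N.

Lemma semigroupW0 m : semigroupW m 0.
Proof. by exists (fun=> 0%N); rewrite big1. Qed.

Lemma semigroupWD m x y :
  semigroupW m x -> semigroupW m y -> semigroupW m (x + y).
Proof.
move=> [c ->] [c' ->]; exists (fun p => c p + c' p)%N.
by rewrite -big_split; apply: eq_bigr => p _; rewrite mulnDl.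
Qed.

Lemma semigroupW_sum m (I : eqType) (r : seq I) (P : pred I) (F : I -> nat) :
  {in r, forall i, P i -> semigroupW m (F i)} ->
  semigroupW m (\sum_(i <- r | P i) F i)%N.
Proof.
move=> WF; rewrite big_seq_cond.
apply: (big_ind (semigroupW m)) => [||i /andP[ri Pi]]; last exact: WF.
  exact: semigroupW0.
exact: semigroupWD.
Qed.

Lemma semigroupW_dvd m p x : p \in primes m -> (p %| x)%N -> semigroupW m x.
Proof.
move=> pm /dvdnP[k ->]; exists (fun q => if q == p then k else 0%N).
rewrite (bigD1_seq p) ?primes_uniq //= eqxx big1 ?addn0 // => q /negPf->.
by rewrite mul0n.
Qed.

(** Every integer exceeding the Frobenius number [p * q - p - q] of two coprime
integers is a nonnegative combination of them. *)
Lemma coin_problem p q x : coprime p q -> (0 < p)%N -> (0 < q)%N ->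
  (p.-1 * q.-1 <= x)%N -> exists a b, x = (a * p + b * q)%N.
Proof.
move=> co_pq p0 q0 le_x.
pose b := (chinese p q x 0 %/ q %% p)%N.
have q_dvd : (q %| chinese p q x 0)%N by rewrite /dvdn chinese_modr // mod0n.
have bx : b * q = x %[mod p].
  by rewrite -modnMml /b modn_mod modnMml divnK // chinese_modl.
(* [b] is the least solution of [b * q = x %[mod p]]. *)
have [le_bx | lt_xb] := leqP (b * q) x.
  have /dvdnP[a ax] : (p %| x - b * q)%N by rewrite -eqn_mod_dvd //; apply/eqP.
  by exists a, b; rewrite -ax subnK.
(* Otherwise [b * q - x] is a positive multiple of [p], while [b < p]. *)
have /dvdnP[a ax] : (p %| b * q - x)%N.
  by rewrite -eqn_mod_dvd ?(ltnW lt_xb) //; apply/eqP.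
have a0 : (0 < a)%N by case: a ax => // /eqP; rewrite subn_eq0 leqNgt lt_xb.
have bp : (b <= p.-1)%N by rewrite -ltnS prednK // ltn_mod.
have : (b * q <= p.-1 * q)%N by rewrite leq_mul2r bp orbT.
rewrite -(subnK (ltnW lt_xb)) ax => le_pq.
have le_pap : (p <= a * p)%N by rewrite leq_pmull.
have := leq_trans (leq_add le_pap le_x) le_pq.
have -> : (p.-1 * q = p.-1 + p.-1 * q.-1)%N by rewrite -mulnS prednK.
by rewrite leq_add2r leqNgt prednK // leqnn.
Qed.

Lemma semigroupW_large m p q x : p \in primes m -> q \in primes m -> p != q ->
  (p.-1 * q.-1 <= x)%N -> semigroupW m x.
Proof.
move=> pm qm npq le_x.
have [p_pr q_pr] : prime p /\ prime q.
  by split; [move: pm | move: qm]; rewrite mem_primes => /andP[].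
have [|a [b ->]] := coin_problem _ (prime_gt0 p_pr) (prime_gt0 q_pr) le_x.
  by rewrite prime_coprime // dvdn_prime2.
apply: semigroupWD; first exact: (semigroupW_dvd pm) (dvdn_mull _ _).
exact: (semigroupW_dvd qm) (dvdn_mull _ _).
Qed.

Lemma leq_totient_two_primes d p q :
  p \in primes d -> q \in primes d -> p != q -> (p.-1 * q.-1 <= totient d)%N.
Proof.
move=> pd qd npq.
have d0 : (0 < d)%N by move: pd; rewrite mem_primes => /and3P[].
have term_gt0 r : r \in primes d -> (0 < r.-1 * r ^ (logn r d).-1)%N.
  by rewrite mem_primes muln_gt0 expn_gt0 => /andP[/prime_gt1]; case: r => [|[]].
rewrite totientE // (big_rem p) //= (big_rem q) /=; last first.
  by rewrite mem_rem_uniq ?primes_uniq // inE eq_sym npq.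
have rest_gt0 : (0 < \prod_(r <- rem q (rem p (primes d)))
    (r.-1 * r ^ (logn r d).-1))%N.
  by rewrite big_seq prodn_cond_gt0 // => r /mem_rem/mem_rem/term_gt0.
rewrite mulnA; apply: leq_trans (leq_pmulr _ rest_gt0).
have pow_gt0 r : r \in primes d -> (0 < r ^ (logn r d).-1)%N.
  by move/term_gt0; rewrite muln_gt0 => /andP[].
by rewrite leq_mul // leq_pmulr // pow_gt0.
Qed.

(** * Arithmetic modulo an integer *)

(** The units modulo [m] surject onto the units modulo a divisor [d] of [m]. *)
Lemma coprime_lift k d m : (0 < m)%N -> (d %| m)%N -> coprime k d ->
  exists k', [/\ k' = k %[mod d] & coprime k' m].
Proof.
move=> m0 dm co_kd; have d0 := dvdn_gt0 m0 dm.
pose u := (m`_(\pi(d)))%N; pose v := (m`_(\pi(d)^'))%N.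
(* [u] has the same prime divisors as [d], and [v] is prime to [d]; take a number
   congruent to [k] modulo [u] and to [1] modulo [v]. *)
have mE : m = (u * v)%N by rewrite partnC.
have co_uv : coprime u v by apply: coprime_partC.
have du : (d %| u)%N.
  by rewrite -(part_pnat_id (pnat_pi d0)) partn_dvd.
(* Adding [d] to [k] changes nothing modulo [d] and makes it positive. *)
have co_ku : coprime (k + d) u.
  have u_pi : \pi(d).-nat u by apply: part_pnat.
  rewrite coprime_sym; apply: pnat_coprime u_pi _.
  by rewrite -coprime_pi' ?addn_gt0 ?d0 ?orbT // /coprime gcdnDr gcdnC.
exists (chinese u v (k + d) 1); split.
  by apply/eqP; rewrite -(modn_dvdm _ du) chinese_modl // modn_dvdm // modnDr.
rewrite mE coprimeMr -coprime_modl chinese_modl // coprime_modl co_ku.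
by rewrite -coprime_modl chinese_modr // coprime_modl coprime1n.
Qed.

Lemma coprime_inv_mod k m : coprime k m -> exists l, k * l = 1 %[mod m].
Proof.
move=> co_km; exists (chinese k m 0 1 %/ k)%N.
by rewrite mulnC divnK ?chinese_modr // /dvdn chinese_modl // mod0n.
Qed.

(** * Multisets of roots of unity stable under the Galois action *)

Lemma expr_coprime_inj (R : comNzRingType) m k : (0 < m)%N -> coprime k m ->
  {in [pred x : R | x ^+ m == 1] &, injective (fun x => x ^+ k)}.
Proof.
move=> m0 /coprime_inv_mod[l kl] x y /eqP xm /eqP ym /= eq_xy.
have powK z : z ^+ m = 1 -> z ^+ k ^+ l = z.
  by move=> zm; rewrite -exprM -(expr_mod _ zm) kl expr_mod.
by rewrite -[x]powK // -[y]powK // eq_xy.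
Qed.

(** A sum over a Galois-stable multiset of [m]-th roots of unity, grouped by the
order [d] of the roots: [zeta ^+ (m %/ d)] is a primitive [d]-th root of unity,
its powers of exponent coprime to [d] are all of them, and they all have the same
multiplicity in [E]. *)
Lemma sum_order_classes m (zeta : algC) (E : seq algC) (f : algC -> algC) :
  m.-primitive_root zeta -> {in E, forall x, x ^+ m = 1} ->
  (forall k, coprime k m -> perm_eq E [seq x ^+ k | x <- E]) ->
  \sum_(x <- E) f x =
  \sum_(d <- divisors m) (count_mem (zeta ^+ (m %/ d)) E)%:R *
    \sum_(k < d | coprime k d) f (zeta ^+ (m %/ d) ^+ k).
Proof.
move=> zetaP Em Egal; have m0 := prim_order_gt0 zetaP.
pose z d := zeta ^+ (m %/ d).
have zP d : d \in divisors m -> d.-primitive_root (z d).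
  by rewrite -dvdn_divisors // => /(dvdn_prim_root zetaP).
(* The multiplicity in [E] of a root of unity depends only on its order. *)
have countE d k : d \in divisors m -> coprime k d ->
    count_mem (z d ^+ k) E = count_mem (z d) E.
  rewrite -dvdn_divisors // => d_m /(coprime_lift m0 d_m)[k' [kk' co_k'm]].
  have dm : d \in divisors m by rewrite -dvdn_divisors.
  have <- : z d ^+ k' = z d ^+ k.
    by apply/eqP; rewrite (eq_prim_root_expr (zP d dm)) kk'.
  rewrite (seq.permP (Egal k' co_k'm)) count_map.
  apply: eq_in_count => x xE /=; apply/eqP/eqP => [|-> //].
  apply: (expr_coprime_inj m0 co_k'm) => //; apply/eqP; first exact: Em.
  by rewrite exprAC (prim_expr_order zetaP) expr1n.
have sumE x : x \in E -> f x = \sum_(d <- divisors m)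
    \sum_(k < d | coprime k d) (x == z d ^+ k)%:R * f (z d ^+ k).
  move=> xE; have [d dP dm] := prim_order_exists m0 (Em x xE).
  have {}dm : d \in divisors m by rewrite -dvdn_divisors.
  have [k xk] := prim_rootP (zP d dm) (prim_expr_order dP).
  have co_kd : coprime k d.
    by rewrite -(prim_root_exp_coprime _ (zP d dm)) -xk.
  rewrite (bigD1_seq d) ?divisors_uniq //= (bigD1 k) //= -xk eqxx mul1r.
  rewrite big1 => [|i /andP[_ nik]]; last first.
    rewrite xk (eq_prim_root_expr (zP d dm)) !modn_small // [_ == _ :> nat]eq_sym.
    by rewrite val_eqE (negPf nik) mul0r.
  rewrite addr0 big1_seq ?addr0 // => e /andP[ned em]; apply: big1 => i co_ie.
  case: eqP => [xi | _]; last by rewrite mul0r.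
  have eP : e.-primitive_root x by rewrite xi prim_root_exp_coprime ?zP.
  case/eqP: ned; apply/eqP; rewrite eqn_dvd (prim_order_dvd eP).
  by rewrite (prim_expr_order dP) (prim_order_dvd dP) (prim_expr_order eP) eqxx.
rewrite big_seq (eq_bigr _ sumE) -big_seq exchange_big /=.
rewrite !big_seq; apply: eq_bigr => d dm.
rewrite exchange_big mulr_sumr; apply: eq_bigr => k co_kd /=.
rewrite -mulr_suml -(countE d k dm co_kd) -sum1_count natr_sum.
by congr (_ * _); rewrite [RHS]big_mkcond; apply: eq_bigr => x _ /=; case: eqP.
Qed.

Lemma prime_power_of_primes d : (0 < d)%N -> (size (primes d) <= 1)%N ->
  d = 1%N \/ exists p a, [/\ p \in primes d, prime p & d = (p ^ a.+1)%N].
Proof.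
move=> d0; case Dd: (primes d) => [|p [|//]] _.
  by left; apply/eqP; rewrite eqn_leq d0 andbT -ltnS -primes_eq0 Dd.
have p_d : p \in primes d by rewrite Dd inE.
have p_pr : prime p by move: p_d; rewrite mem_primes => /andP[].
have /p_natP[[|a] da] : p.-nat d.
- apply/pnatP => // q q_pr q_d; rewrite inE /=.
  have : q \in primes d by rewrite mem_primes q_pr d0.
  by rewrite Dd inE.
- by left.
- by right; exists p, a; rewrite inE.
Qed.

Lemma sum_prim_root_pow (R : idomainType) n (z : R) :
  n.-primitive_root z -> (1 < n)%N -> \sum_(k < n) z ^+ k = 0.
Proof.
move=> zP n1; have /eqP := subrX1 z n.
rewrite (prim_expr_order zP) subrr eq_sym mulf_eq0 subr_eq0 -(expr1 z).
by rewrite -(prim_order_dvd zP) dvdn1 gtn_eqF //= => /eqP.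
Qed.

Lemma sum_prim_roots_prime (R : idomainType) p (z : R) :
  prime p -> p.-primitive_root z -> \sum_(k < p | coprime k p) z ^+ k = -1.
Proof.
move=> p_pr zP; have := sum_prim_root_pow zP (prime_gt1 p_pr).
pose i0 := Ordinal (prime_gt0 p_pr).
rewrite (bigD1 i0) //= expr0 => /eqP; rewrite addrC addr_eq0 => /eqP <-.
apply: eq_bigl => k; rewrite coprime_sym prime_coprime //.
rewrite -val_eqE /=; case: k => [[|k] lt_kp] /=; first by rewrite dvdn0.
by apply/esym; rewrite gtnNdvd.
Qed.

Lemma sum_prim_roots_square (R : idomainType) d p (z : R) :
  prime p -> (p ^ 2 %| d)%N -> d.-primitive_root z ->
  \sum_(k < d | coprime k d) z ^+ k = 0.
Proof.
move=> p_pr p2d zP; have d0 := prim_order_gt0 zP.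
have pd : (p %| d)%N by apply: dvdn_trans p2d; rewrite dvdn_exp.
pose t := (d %/ p)%N; pose h (k : 'I_d) := Ordinal (ltn_pmod (k + t) d0).
have hinj : injective h.
  move=> i j [/eqP]; rewrite eqn_modDr !modn_small // => /eqP; exact: val_inj.
(* [d] and [t] have the same prime divisors, as [t %| d] and [d %| t ^ 2]. *)
have coprime_dt x : coprime x d = coprime x t.
  apply/idP/idP; first by apply: coprime_dvdr; rewrite dvdn_div.
  rewrite -(@coprime_pexpr 2) // => /(coprime_dvdr _)-> //.
  have /dvdnP[e de] := p2d.
  have tE : t = (e * p)%N by rewrite /t de mulnA mulnK ?prime_gt0.
  by rewrite tE de expnMn dvdn_mul // dvdn_exp.
have co_h k : coprime (h k) d = coprime k d.
  by rewrite /= coprime_modl !coprime_dt /coprime gcdnC gcdnDr gcdnC.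
(* Multiplication by [z ^+ t], a [p]-th root of unity other than [1], permutes
   the primitive [d]-th roots of unity. *)
set S := \sum_(k < d | _) _; have SE : S = z ^+ t * S.
  rewrite {1}/S (reindex_inj hinj) mulr_sumr; apply: eq_big => [k|k _] //.
  by rewrite /= (prim_expr_mod zP) exprD mulrC.
have : (1 - z ^+ t) * S = 0 by rewrite mulrBl mul1r -SE subrr.
move/eqP; rewrite mulf_eq0 subr_eq0 eq_sym -(prim_order_dvd zP) => /orP[|/eqP //].
move=> /dvdn_leq; rewrite divn_gt0 ?prime_gt0 // dvdn_leq // leqNgt.
by rewrite ltn_Pdiv ?prime_gt1 // => /(_ isT).
Qed.

(** The arithmetic core of the theorem: a Galois-stable form of the statement that
the number of terms in a vanishing sum of [m]-th roots of unity lies in W(m). *)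
Lemma sum_galois_stable_eq0 m (E : seq algC) : (0 < m)%N ->
  {in E, forall x, x ^+ m = 1} ->
  (forall k, coprime k m -> perm_eq E [seq x ^+ k | x <- E]) ->
  \sum_(x <- E) x = 0 -> semigroupW m (size E).
Proof.
move=> m0 Em Egal sumE0; have [zeta zetaP] := C_prim_root_exists m0.
pose c d := count_mem (zeta ^+ (m %/ d)) E.
have sizeE : size E = (\sum_(d <- divisors m) c d * totient d)%N.
  apply/eqP; rewrite -(eqr_nat algC) -sum1_size natr_sum.
  rewrite (sum_order_classes (fun=> 1) zetaP Em Egal) natr_sum; apply/eqP.
  apply: eq_bigr => d _; rewrite natrM; congr (_ * _).
  rewrite totient_count_coprime big_mkord natr_sum big_mkcond.
  by apply: eq_bigr => k _; rewrite coprime_sym; case: coprime.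
(* Either some [d] with two distinct prime divisors occurs, and the size is beyond
   the Frobenius number, or only [1] and prime powers occur. *)
pose two_primes d := ((c d != 0) && (1 < size (primes d)))%N.
have [|] := boolP (has two_primes (divisors m)).
  case/hasP => d d_m /andP[cd]; case Dd: (primes d) => [|p [|q s]] // _.
  have npq : p != q.
    by have := primes_uniq d; rewrite Dd /= inE negb_or -andbA => /andP[].
  have p_d : p \in primes d by rewrite Dd inE eqxx.
  have q_d : q \in primes d by rewrite Dd !inE eqxx orbT.
  have sub_dm : {subset primes d <= primes m}.
    move=> r; rewrite !mem_primes m0 => /and3P[-> _ /= /dvdn_trans->] //.
    by rewrite dvdn_divisors.
  apply: (semigroupW_large (sub_dm _ p_d) (sub_dm _ q_d) npq).
  apply: leq_trans (leq_totient_two_primes p_d q_d npq) _.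
  rewrite sizeE (bigD1_seq d) ?divisors_uniq //=.
  by apply: leq_trans (leq_addr _ _); rewrite leq_pmull // lt0n.
move=> /hasPn prim_pow.
have pp d : d \in divisors m -> c d != 0%N ->
    d = 1%N \/ exists p a, [/\ p \in primes m, prime p & d = (p ^ a.+1)%N].
  move=> d_m cd; have := prim_pow d d_m; rewrite /two_primes cd -leqNgt /=.
  move: (d_m); rewrite -dvdn_divisors // => dm.
  case/(prime_power_of_primes (dvdn_gt0 m0 dm)) => [|[p [a [p_d p_pr dE]]]].
    by left.
  right; exists p, a; split=> //; move: p_d; rewrite !mem_primes m0.
  by case/and3P=> -> _ /dvdn_trans->.
have div1 : 1%N \in divisors m by rewrite -dvdn_divisors.
have prime_power_pf p a : prime p -> (0 < a)%N -> ~~ prime (p ^ a.+1).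
  move=> p_pr a0; apply/negP => /primeP[_ /(_ p)].
  rewrite dvdn_exp // => /(_ isT); rewrite (gtn_eqF (prime_gt1 p_pr)) /=.
  by rewrite -[X in X == _]expn1 eqn_exp2l ?prime_gt1 // eqSS ltn_eqF.
(* The sum over [E] is [\sum_d c d * mu d], where [mu d] is the sum of the
   primitive [d]-th roots of unity; only [d = 1] and [d] prime contribute. *)
have c1E : c 1%N = (\sum_(d <- divisors m | prime d) c d)%N.
  have termE d : d \in divisors m ->
    (c d)%:R * (\sum_(k < d | coprime k d) zeta ^+ (m %/ d) ^+ k) =
    (if d == 1%N then c d else 0%N)%:R - (if prime d then c d else 0%N)%:R.
    move=> d_m; have [c0 | cd] := eqVneq (c d) 0%N.
      by rewrite c0 mul0r !if_same subrr.
    have zP : d.-primitive_root (zeta ^+ (m %/ d)).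
      by apply: dvdn_prim_root zetaP _ _; rewrite dvdn_divisors.
    have [d1 | [p [[|a] [p_m p_pr dE]]]] := pp d d_m cd.
    - by rewrite d1 big_mkcond big_ord1 /= expr0 mulr1 subr0.
    - rewrite expn1 in dE; rewrite dE p_pr gtn_eqF ?prime_gt1 // sub0r -dE.
      by rewrite (sum_prim_roots_prime _ zP) ?dE // mulrN1.
    - rewrite (sum_prim_roots_square p_pr _ zP); last by rewrite dE dvdn_exp2l.
      rewrite mulr0 dE (negPf (prime_power_pf _ _ _ _)) // gtn_eqF ?subrr //.
      by rewrite -(exp1n a.+2) ltn_exp2r // prime_gt1.
  apply/eqP; rewrite -(eqr_nat algC) -subr_eq0 -[X in _ == X]sumE0.
  rewrite (sum_order_classes id zetaP Em Egal) big_seq (eq_bigr _ termE) -big_seq.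
  rewrite big_split sumrN -!natr_sum /= -!big_mkcond /=; apply/eqP.
  congr (_%:R - _).
  by rewrite -big_filter filter_pred1_uniq ?divisors_uniq // big_seq1.
rewrite sizeE (bigD1_seq 1%N) ?divisors_uniq //= muln1 c1E.
rewrite (bigID prime (fun d => d != 1%N)) /= addnA.
apply: semigroupWD.
  (* [c 1], expressed by [c1E], adds [c p] to [c p * p.-1] for each prime [p]. *)
  have -> : (\sum_(d <- divisors m | (d != 1) && prime d) c d * totient d =
             \sum_(d <- divisors m | prime d) c d * totient d)%N.
    by apply: eq_bigl => d; case: eqP => // ->.
  rewrite -big_split; apply: semigroupW_sum => d d_m d_pr.
  rewrite totient_prime //= -mulnS prednK ?prime_gt0 //.
  apply: (semigroupW_dvd (p := d)); last exact: dvdn_mull.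
  by rewrite mem_primes d_pr m0 dvdn_divisors.
apply: semigroupW_sum => d d_m /andP[d1 dNprime].
have [->|cd] := eqVneq (c d) 0%N; first exact: semigroupW0.
have [dE|[p [[|a] [p_m p_pr dE]]]] := pp d d_m cd.
- by rewrite dE in d1.
- by rewrite dE expn1 p_pr in dNprime.
apply: semigroupW_dvd p_m _.
by rewrite dE totient_pfactor //= !dvdn_mull // dvdn_exp.
Qed.

(** * Powers and cycle types of permutations *)

Local Open Scope group_scope.

(** A power of [g] prime to its order has the same cycles as [g], up to the order
in which each is run through. With [rep] choosing a point in each cycle, a
conjugating permutation sends [(g ^+ i) (rep y)] to [(g ^+ (i * k)) (rep y)]. *)
Lemma perm_pow_conj (T : finType) (g : {perm T}) k :
  coprime k #[g] -> exists s : {perm T}, g ^ s = g ^+ k.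
Proof.
move=> co_kg.
pose rep y := odflt y [pick z in porbit g y].
have eq_rep y z : porbit g y = porbit g z -> rep y = rep z.
  by rewrite /rep => ->; case: pickP => // /(_ z); rewrite porbit_id.
have rep_mem y : y \in porbit g (rep y).
  by rewrite porbit_sym /rep; case: pickP => [z //|/(_ y)]; rewrite porbit_id.
have repK y : rep (rep y) = rep y.
  by apply: eq_rep; apply/eqP; rewrite eq_sym eq_porbit_mem rep_mem.
have rep_pow i y : rep ((g ^+ i) y) = rep y by apply: eq_rep; rewrite porbit_perm.
have idxP y : exists i, (g ^+ i) (rep y) == y.
  by have /porbitP[i yE] := rep_mem y; exists i; rewrite -yE.
pose idx y := xchoose (idxP y).
have idxE y : (g ^+ idx y) (rep y) = y by apply/eqP/(xchooseP (idxP y)).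
have pow_agree l i j x :
    (g ^+ i) x = (g ^+ j) x -> (g ^+ (i * l)) x = (g ^+ (j * l)) x.
  wlog le_ij : i j / (i <= j)%N.
    by move=> IH; case: (leqP i j) => [|/ltnW] /IH // IH' /esym/IH'.
  move=> eq_ij; rewrite -(subnK le_ij).
  have fix_x : (g ^+ (j - i)) x = x.
    by apply: (@perm_inj _ (g ^+ i)); rewrite -permM -expgD subnK.
  rewrite mulnDl expgD permM; congr (_ _).
  rewrite expgM; elim: l => [|l IHl]; first by rewrite expg0 perm1.
  by rewrite expgSr permM -IHl fix_x.
(* [f y] does not depend on the choice of [idx y], by [pow_agree]. *)
pose f y := (g ^+ (idx y * k)) (rep y).
have f_inj : injective f.
  have [l kl] := coprime_inv_mod co_kg.
  have powK i : g ^+ (i * k * l) = g ^+ i.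
    by apply/eqP; rewrite eq_expg_mod_order -mulnA -modnMmr kl modnMmr muln1.
  move=> y z eq_f; have rep_yz : rep y = rep z.
    by have := congr1 rep eq_f; rewrite !rep_pow !repK.
  rewrite -(idxE y) -(idxE z) -rep_yz.
  by have := eq_f; rewrite /f -rep_yz => /(pow_agree l); rewrite !powK.
exists (perm f_inj); apply/permP => y.
rewrite -[y](permKV (perm f_inj)) permJ; set z := (perm f_inj)^-1 y.
rewrite !permE /f.
have rep_gz : rep (g z) = rep z by rewrite -{1}[g]expg1 rep_pow.
rewrite rep_gz -permM -expgD -mulSnr; apply: pow_agree.
by rewrite -{1}rep_gz idxE expgSr permM idxE.
Qed.

Lemma has_cycle_type_expg n (g : 'S_n) beta :
  has_cycle_type g beta -> g ^+ lcm_seq beta = 1.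
Proof.
move=> g_beta; apply/permP => x; rewrite perm1.
have b_beta : #|porbit g x| \in beta.
  rewrite -(perm_mem g_beta); apply: (map_f (fun X : {set _} => #|X|)).
  by rewrite mem_enum imset_f.
have /dvdnP[k ->] : (#|porbit g x| %| lcm_seq beta)%N.
  by rewrite /lcm_seq (big_rem _ b_beta) dvdn_lcml.
rewrite mulnC expgM.
have fix_x : (g ^+ #|porbit g x|) x = x by rewrite permX iter_porbit.
by elim: k => [|k IHk]; rewrite ?perm1 // expgSr permM IHk.
Qed.

Lemma lcm_seq_gt0 beta : all (ltn 0) beta -> (0 < lcm_seq beta)%N.
Proof.
rewrite /lcm_seq; elim: beta => [|b s IHs]; first by rewrite big_nil.
by rewrite big_cons lcmn_gt0 /= => /andP[-> /IHs].
Qed.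

Local Close Scope group_scope.

(** * Eigenvalues in representations of the symmetric group *)

Lemma char_poly_conj (R : comUnitRingType) n (A B : 'M[R]_n) :
  B \in unitmx -> char_poly (invmx B *m A *m B) = char_poly A.
Proof.
move=> uB; rewrite /char_poly /char_poly_mx.
pose P := map_mx polyC B; pose Q := map_mx polyC (invmx B).
have QP : Q *m P = 1%:M by rewrite -map_mxM mulVmx // map_mx1.
have -> : 'X%:M - map_mx polyC (invmx B *m A *m B) =
    Q *m ('X%:M - map_mx polyC A) *m P.
  by rewrite mulmxBr mulmxBl !map_mxM scalar_mxC -(mulmxA _ Q P) QP mulmx1.
by rewrite !det_mulmx mulrAC -det_mulmx QP det1 mul1r.
Qed.

Lemma char_poly_diag (R : comNzRingType) n (e : 'rV[R]_n) :
  char_poly (diag_mx e) = \prod_(x <- [seq e 0 i | i <- enum 'I_n]) ('X - x%:P).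
Proof.
rewrite char_poly_trig ?diag_mx_is_trig // big_map enumT.
by apply: eq_bigr => i _; rewrite mxE eqxx.
Qed.

(** The theorem for an arbitrary representation, of degree [f]. *)
Lemma repr_Sym_eq0 n f (rG : mx_representation algC [set: 'S_n] f) g m :
  (0 < m)%N -> (g ^+ m)%g = 1%g -> cfRepr rG g = 0 -> semigroupW m f.
Proof.
move=> m0 gm chi0.
have [e [[B uB rGg] [eg _] [chi_e _] _]] := repr_rsim_diag rG (in_setT g).
pose E := [seq e 0 i | i <- enum 'I_f].
have g_m : (#[g]%g %| m)%N by rewrite order_dvdn gm.
have <- : size E = f by rewrite size_map size_enum_ord.
apply: sum_galois_stable_eq0 => // [_ /mapP[i _ ->]|k co_km|].
- by rewrite -(divnK g_m) mulnC exprM eg expr1n.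
(* [rG g] and [rG (g ^+ k)] are similar, so the diagonal matrices of [e] and of its
   [k]-th powers have the same characteristic polynomial. *)
- have [s gs] := perm_pow_conj (coprime_dvdr g_m co_km).
  pose ek := \row_i e 0 i ^+ k.
  have -> : [seq x ^+ k | x <- E] = [seq ek 0 i | i <- enum 'I_f].
    by rewrite -map_comp; apply: eq_map => i /=; rewrite mxE.
  have rGgk : rG (g ^+ k)%g = invmx B *m diag_mx ek *m B.
    rewrite /ek; elim: (k) => [|j IHj].
      rewrite repr_mx1 -[X in diag_mx X](_ : const_mx 1 = _).
        by rewrite diag_const_mx mulmx1 mulVmx.
      by apply/rowP=> i; rewrite !mxE.
    rewrite expgSr repr_mxM ?in_setT // IHj rGg !mulmxA mulmxK //.
    rewrite -(mulmxA (invmx B) _ (diag_mx e)) mulmx_diag.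
    by congr (_ *m diag_mx _ *m _); apply/rowP=> i; rewrite !mxE exprSr.
  apply: prod_XsubC_eq; rewrite -!char_poly_diag.
  rewrite -(char_poly_conj _ uB) -rGg -[RHS](char_poly_conj _ uB) -rGgk -gs.
  rewrite conjgE !repr_mxM ?groupV ?in_setT // repr_mxV ?in_setT // mulmxA.
  by rewrite char_poly_conj // repr_mx_unit ?in_setT.
by rewrite big_map enumT -chi_e.
Qed.

Theorem theorem3p1 (n : nat) (alpha beta : seq nat)
    (alpha_part : is_partition n alpha) (beta_part : is_partition n beta) :
  ~ in_W (lcm_seq beta) (sym_char n alpha 1%g) ->
  forall g : 'S_n, has_cycle_type g beta -> sym_char n alpha g <> 0.
Proof.
move=> notW g g_beta chi0; apply: notW.
have /and3P[_ beta_gt0 _] := beta_part.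
have lcm_gt0 := lcm_seq_gt0 beta_gt0.
have [c fE] := repr_Sym_eq0 lcm_gt0 (has_cycle_type_expg g_beta) chi0.
by exists c; rewrite -fE /sym_char cfRepr1.
Qed.
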